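(* Let $a_n$ be the number of paths in $\mathcal{M}_2$ of length $n$ (ending at any height). Then $$\sum_{n\ge0}a_nz^n=\frac{1}{z(r-1)},\qquad\text{where } r=\frac{z+1+\sqrt{1-2z-3z^{2}}}{2z(z+1)}.$$
   Context: Let $U=(1,1)$, $H=(1,0)$ and $D_k=(1,-k)$ for $k\ge 1$ (down steps). $\mathcal{M}_2$ is the set of lattice paths in $\mathbb{N}^2$ (with $\mathbb{N}=\{0,1,2,\dots\}$, so paths never go below the $x$-axis) starting at the origin, made of steps $U$, $H$ and $D_k$ ($k\ge1$), in which every down step and every horizontal step, except possibly when it is the last step of the path, is immediately followed by an up step $U$. The empty path belongs to $\mathcal{M}_2$. The length of a path is its number of steps. The square root is the power series with constant term $1$, and $r$ is a Laurent series in $z$. *)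

(* Defs.v *)
From HB Require Import structures.
From mathcomp Require Import all_boot all_order all_algebra.
From mathcomp Require Import finmap boolp classical_sets functions cardinality.

Set Implicit Arguments.
Unset Strict Implicit.
Unset Printing Implicit Defensive.

Import Order.TTheory GRing.Theory Num.Theory.

Local Open Scope ring_scope.

(* [Down k] is the step D_{k+1} = (1, -(k+1)), so that k : nat ranges over all
   the down steps D_1, D_2, ... without a side condition. *)
Inductive step : Type := Up | Hor | Down of nat.

Definition step_code (s : step) : option (option nat) :=
  match s with Up => None | Hor => Some None | Down k => Some (Some k) end.

Definition step_decode (c : option (option nat)) : step :=
  match c with None => Up | Some None => Hor | Some (Some k) => Down k end.

Lemma step_codeK : cancel step_code step_decode.
Proof. by case. Qed.

HB.instance Definition _ := Countable.copy step (can_type step_codeK).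

Definition rise (s : step) : int :=
  match s with Up => 1 | Hor => 0 | Down k => - (k.+1)%:Z end.

(* Every step has horizontal component 1, so a path from the origin visits
   exactly the points (i, height (take i p)) for i <= size p. *)
Definition height (p : seq step) : int := \sum_(s <- p) rise s.

Definition in_quadrant (p : seq step) : bool :=
  [forall i : 'I_(size p).+1, 0 <= height (take i p)].

(* [sorted e p] says that e holds between any two consecutive entries of p,
   so the last step is unconstrained. *)
Definition up_after_nonup (p : seq step) : bool :=
  sorted (fun s t => (s != Up) ==> (t == Up)) p.

Definition M2 : set (seq step) :=
  [set p | in_quadrant p && up_after_nonup p]%classic.

Definition M2_of_length (n : nat) : set (seq step) :=
  [set p | M2 p /\ size p = n]%classic.

(* [fset_set] is only meaningful on finite sets: see [finite_M2_of_length]. *)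
Definition a (n : nat) : nat := #|` fset_set (M2_of_length n)|.

Lemma height_take_le (p : seq step) (i : nat) : height (take i p) <= i%:Z.
Proof.
rewrite /height; elim: i p => [|i IH] [|s p] /=; rewrite ?big_nil //.
rewrite big_cons -add1n PoszD; apply: lerD; last exact: IH.
by case: s.
Qed.

Lemma M2_down_bound (p : seq step) (k : nat) :
  in_quadrant p -> Down k \in p -> (k < size p)%N.
Proof.
move=> /forallP Hp Hk.
have Hi : (index (Down k) p < size p)%N by rewrite index_mem.
have := Hp (@Ordinal (size p).+1 (index (Down k) p).+1 Hi) => /=.
rewrite (take_nth Up Hi) nth_index // /height big_rcons /=.
rewrite subr_ge0 => H.
have := le_trans H (height_take_le p _); rewrite lez_nat => H'.
exact: leq_trans H' (ltnW Hi).
Qed.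

Lemma finite_M2_of_length (n : nat) : finite_set (M2_of_length n).
Proof.
pose dec (c : option (option 'I_n)) : step :=
  match c with
  | None => Up | Some None => Hor | Some (Some k) => Down k end.
pose f (t : n.-tuple (option (option 'I_n))) : seq step := map dec t.
apply: (@sub_finite_set _ _ (f @` setT)%classic); last first.
  by apply: finite_image; exact: finite_finset.
move=> p [/andP[Hp _] sz].
have Hb k : Down k \in p -> (k < n)%N.
  by rewrite -sz; exact: M2_down_bound.
pose enc (s : step) : option (option 'I_n) :=
  match s with Up => None | Hor => Some None | Down k => Some (insub k) end.
have szp : size (map enc p) == n by rewrite size_map sz.
exists (Tuple szp) => //; rewrite /f /= -map_comp -[RHS]map_id.
apply/eq_in_map => -[||k] //= /Hb Hk.
by rewrite insubT.
Qed.

Record fps (R : Type) : Type := FPS { coef : nat -> R }.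

HB.instance Definition _ (R : Type) := [isNew for @coef R].
HB.instance Definition _ (R : choiceType) := [Choice of fps R by <:].

Section FpsRing.
Context {R : comNzRingType}.
Implicit Types x y : fps R.

Definition fps0 : fps R := FPS (fun=> 0).
Definition fps1 : fps R := FPS (fun n => (n == 0%N)%:R).
Definition fpsN x : fps R := FPS (fun n => - coef x n).
Definition fpsD x y : fps R := FPS (fun n => coef x n + coef y n).
Definition fpsM x y : fps R :=
  FPS (fun n => \sum_(i < n.+1) coef x i * coef y (n - i)).
Definition fpsX : fps R := FPS (fun n => (n == 1%N)%:R).

Lemma fpsP x y : (forall n, coef x n = coef y n) -> x = y.
Proof. by case: x y => [u] [v] /= /funext ->. Qed.

Fact fpsDA : associative fpsD.
Proof. by move=> x y z; apply: fpsP => n /=; rewrite addrA. Qed.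
Fact fpsDC : commutative fpsD.
Proof. by move=> x y; apply: fpsP => n /=; rewrite addrC. Qed.
Fact fps0D : left_id fps0 fpsD.
Proof. by move=> x; apply: fpsP => n /=; rewrite add0r. Qed.
Fact fpsND : left_inverse fps0 fpsN fpsD.
Proof. by move=> x; apply: fpsP => n /=; rewrite addNr. Qed.

HB.instance Definition _ := GRing.isZmodule.Build (fps R) fpsDA fpsDC fps0D fpsND.

Fact fpsMC : commutative fpsM.
Proof.
move=> x y; apply: fpsP => n /=.
rewrite (reindex_inj rev_ord_inj) /=.
by apply: eq_bigr => i _; rewrite mulrC subSS subKn // -ltnS.
Qed.

Fact fpsMA : associative fpsM.
Proof.
move=> p q r; apply: fpsP => i /=.
pose coef3 j k := coef p j * (coef q (i - j - k) * coef r k).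
transitivity (\sum_(j < i.+1) \sum_(k < i.+1 | (k <= i - j)%N) coef3 j k).
  apply: eq_bigr => /= j _.
  have -> : \sum_(i0 < (i - j).+1) coef q i0 * coef r (i - j - i0) =
            coef (fpsM q r) (i - j) by [].
  rewrite fpsMC /= big_distrr /= (big_ord_narrow_leq (leq_subr _ _)).
  by apply: eq_bigr => k _; rewrite /coef3 [coef r _ * _]mulrC.
rewrite (exchange_big_dep predT) //=.
have -> : \sum_(i0 < i.+1) (\sum_(i1 < i0.+1) coef p i1 * coef q (i0 - i1)) *
            coef r (i - i0) = coef (fpsM (fpsM p q) r) i by [].
rewrite fpsMC /=; apply: eq_bigr => k _.
transitivity (\sum_(j < i.+1 | (j <= i - k)%N) coef3 j k).
  apply: eq_bigl => j; rewrite -ltnS -(ltnS j) -!subSn ?leq_ord //.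
  by rewrite -subn_gt0 -(subn_gt0 j) -!subnDA addnC.
rewrite (big_ord_narrow_leq (leq_subr _ _)) mulrC big_distrl /=.
by apply: eq_bigr => j _; rewrite /coef3 -!subnDA addnC mulrA.
Qed.

Fact fps1M : left_id fps1 fpsM.
Proof.
move=> x; apply: fpsP => n /=.
rewrite big_ord_recl subn0 /= mul1r big1 ?addr0 // => i _.
by rewrite mul0r.
Qed.

Fact fpsMDl : left_distributive fpsM fpsD.
Proof.
move=> x y z; apply: fpsP => n /=; rewrite -big_split /=.
by apply: eq_bigr => i _; rewrite mulrDl.
Qed.

Fact fps1_neq0 : fps1 != 0.
Proof.
apply/eqP => /(congr1 (fun x => coef x 0)) /= /eqP.
by rewrite oner_eq0.
Qed.

HB.instance Definition _ := GRing.Zmodule_isComNzRing.Build (fps R)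
  fpsMA fpsMC fps1M fpsMDl fps1_neq0.

Definition fps_unit : {pred fps R} := fun x => `[< exists y, y * x = 1 >].
Definition fps_inv x : fps R := xget x [set y | y * x = 1]%classic.

Fact fps_mulVx : {in fps_unit, left_inverse 1 fps_inv *%R}.
Proof. by move=> x /asboolP ex; apply: (xgetPex x ex). Qed.
Fact fps_unitPl x y : y * x = 1 -> fps_unit x.
Proof. by move=> yx; apply/asboolP; exists y. Qed.
Fact fps_invr_out : {in [predC fps_unit], fps_inv =1 id}.
Proof.
move=> x /asboolP nex; apply: xgetPN => y yx.
by apply: nex; exists y.
Qed.

HB.instance Definition _ := GRing.ComNzRing_hasMulInverse.Build (fps R)
  fps_mulVx fps_unitPl fps_invr_out.

Lemma coef_fps0 n : coef (0 : fps R) n = 0. Proof. by []. Qed.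
Lemma coef_fps1 n : coef (1 : fps R) n = (n == 0%N)%:R. Proof. by []. Qed.
Lemma coef_fpsX n : coef fpsX n = (n == 1%N)%:R. Proof. by []. Qed.
Lemma coef_fpsD x y n : coef (x + y) n = coef x n + coef y n.
Proof. by []. Qed.
Lemma coef_fpsN x n : coef (- x) n = - coef x n. Proof. by []. Qed.
Lemma coef_fpsM x y n :
  coef (x * y) n = \sum_(i < n.+1) coef x i * coef y (n - i).
Proof. by []. Qed.

End FpsRing.

Section FpsIdomain.
Context {R : idomainType}.
Implicit Types x y : fps R.

Lemma fps_neq0_ord x : x != 0 ->
  exists n, coef x n != 0 /\ forall i, (i < n)%N -> coef x i = 0.
Proof.
move=> x0; have ex : exists n, coef x n != 0.
  apply: contrapT => /forallNP H; move/eqP: x0; apply; apply: fpsP => n.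
  by apply/eqP; move/negP: (H n); rewrite negbK.
exists (ex_minn ex); case: ex_minnP => n xn minn; split=> // i.
by apply: contraTeq => /minn; rewrite -leqNgt.
Qed.

Fact fps_mulf_eq0 : GRing.integral_domain_axiom (fps R).
Proof.
move=> x y xy0; apply: contraT; rewrite negb_or => /andP[/fps_neq0_ord[m [xm xlt]] /fps_neq0_ord[n [yn ylt]]].
have := congr1 (fun z => coef z (m + n)%N) xy0.
rewrite coef_fpsM coef_fps0.
have lt_m : (m < (m + n).+1)%N by rewrite ltnS leq_addr.
rewrite (bigD1 (Ordinal lt_m)) //= addKn big1 ?addr0 => [/eqP|i].
  by rewrite mulf_eq0 (negbTE xm) (negbTE yn).
rewrite -val_eqE /= neq_ltn => /orP[/xlt -> | lt_mi]; first by rewrite mul0r.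
rewrite ylt ?mulr0 // ltn_subLR; last by rewrite -ltnS.
by rewrite ltn_add2r.
Qed.

HB.instance Definition _ :=
  GRing.ComUnitRing_isIntegral.Build (fps R) fps_mulf_eq0.

End FpsIdomain.

Section FpsSqrt.
Context {F : fieldType}.
Implicit Types f s t : fps F.

(* The square root with constant term 1, when coef f 0 = 1 and 2 is nonzero in
   F: see [fps_sqrtP] and [fps_sqrt_unique]; otherwise possibly the default 0. *)
Definition fps_sqrt f : fps F :=
  xget 0 [set s | coef s 0 = 1 /\ s ^+ 2 = f]%classic.

Fixpoint sqrt_seq f (n : nat) : seq F :=
  if n is m.+1 then
    let s := sqrt_seq f m in
    rcons s ((coef f m.+1 - \sum_(i < m) s`_i.+1 * s`_(m - i)) / 2)
  else [:: 1].

Lemma size_sqrt_seq f n : size (sqrt_seq f n) = n.+1.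
Proof. by elim: n => //= n IH; rewrite size_rcons IH. Qed.

Lemma nth_sqrt_seq f n i : (i <= n)%N -> (sqrt_seq f n)`_i = (sqrt_seq f i)`_i.
Proof.
elim: n => [|n IH]; first by rewrite leqn0 => /eqP ->.
rewrite leq_eqVlt => /orP[/eqP -> //|lt_in] /=.
by rewrite nth_rcons size_sqrt_seq lt_in IH.
Qed.

Lemma fps_sqrt_exists f : (2 : F) != 0 -> coef f 0 = 1 ->
  exists s, coef s 0 = 1 /\ s ^+ 2 = f.
Proof.
move=> two0 f0; pose u n := (sqrt_seq f n)`_n.
have u0 : u 0%N = 1 by [].
have uS n : u n.+1 = (coef f n.+1 - \sum_(i < n) u i.+1 * u (n - i)%N) / 2.
  rewrite /u /= nth_rcons size_sqrt_seq ltnn eqxx.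
  congr ((_ - _) / _); apply: eq_bigr => i _.
  by rewrite !(@nth_sqrt_seq f n) // ?leq_subr.
exists (FPS u); split=> //; apply: fpsP => -[|n].
  by rewrite expr2 coef_fpsM big_ord1 /= subn0 u0 mulr1 f0.
rewrite expr2 coef_fpsM big_ord_recl big_ord_recr /= subn0 subnn u0 mul1r mulr1.
rewrite addrCA -mulr2n -mulr_natr uS divfK // addrC.
under eq_bigr => i _ do rewrite subSS.
by rewrite subrK.
Qed.

Lemma fps_sqrtP f : (2 : F) != 0 -> coef f 0 = 1 ->
  coef (fps_sqrt f) 0 = 1 /\ fps_sqrt f ^+ 2 = f.
Proof. by move=> two0 f0; apply: (xgetPex 0 (fps_sqrt_exists two0 f0)). Qed.

Lemma fps_sqrt_unique f s t : (2 : F) != 0 ->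
  coef s 0 = 1 -> s ^+ 2 = f -> coef t 0 = 1 -> t ^+ 2 = f -> s = t.
Proof.
move=> two0 s0 sf t0 tf; have /eqP : s ^+ 2 = t ^+ 2 by rewrite sf tf.
rewrite eqf_sqr => /orP[/eqP //|/eqP st].
have := congr1 (fun x => coef x 0) st; rewrite coef_fpsN s0 t0 => /eqP.
by rewrite -subr_eq0 opprK (negbTE two0).
Qed.

End FpsSqrt.

(* The field Q((z)) of formal Laurent series is the fraction field of Q[[z]]. *)
Definition laurent : fieldType := {fraction (fps rat)}.

Definition of_fps (x : fps rat) : laurent := FracField.tofrac x.

Definition z : laurent := of_fps fpsX.

Definition sqrt_disc : laurent :=
  of_fps (fps_sqrt (1 - 2 * fpsX - 3 * fpsX ^+ 2)).

Definition r : laurent := (z + 1 + sqrt_disc) / (2 * z * (z + 1)).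

Definition gen_M2 : laurent := of_fps (FPS (fun n => (a n)%:R)).

(* Main.v *)
Require Import Defs.
From mathcomp Require Import all_boot all_order all_algebra.
From mathcomp Require Import finmap classical_sets cardinality.
From mathcomp Require Import zify ring.

(** Reading a path from left to right, what may follow a prefix depends only on
    the height [h] reached and on whether the last step read forces an up step.
    Let [C h] be the generating function of the unforced continuations from
    height [h], and put [B h = 1 + z C h]. A forced continuation from height [j]
    is empty or an up step followed by an unforced one from [j + 1], so its
    generating function is [B j.+1]. Splitting an unforced continuation
    according to its first step, an up step or a step that leads to some height
    [j <= h] and forces an up step, gives
      [B h = 1 + z B h.+1 + z^2 (B 1 + ... + B h.+1)].
    Comparing coefficients, this system determines all the [B h]: the
    coefficient of [z^(n+1)] on the left only involves smaller ones on the right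
    ([continuations_coef]).

    Subtracting consecutive equations leaves a linear recurrence in [h] with
    constant coefficients, whose characteristic equation
      [x - 1 = z (x^2 - x) + z^2 x^2]
    has the roots [r] and [s = 1 / (z (1 + z) r)]. Only [s] is a power series,
    so the solution is [B h = b s^h] ([small_rootP], [scale_rec]), and the
    equation for [h = 0] fixes [b = 1 / (1 - z (1 + z) s) = 1 / (1 - 1/r)].
    Since [B 0 = b], the generating function sought is
      [(b - 1) / z = 1 / (z (r - 1))]. *)

Set Implicit Arguments.
Unset Strict Implicit.
Unset Printing Implicit Defensive.

Import Order.TTheory GRing.Theory Num.Theory.

Local Open Scope ring_scope.

(** * Invertible power series *)

Section PowerSeries.
Context {R : comNzRingType}.
Implicit Types x y : fps R.

Lemma coef_sum (I : Type) (l : seq I) (F : I -> fps R) n :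
  coef (\sum_(i <- l) F i) n = \sum_(i <- l) coef (F i) n.
Proof. by elim/big_rec2: _ => // i u v _ <-. Qed.

Lemma coef0M x y : coef (x * y) 0 = coef x 0 * coef y 0.
Proof. by rewrite coef_fpsM big_ord1. Qed.

Lemma coefXM0 x : coef (fpsX * x) 0 = 0.
Proof. by rewrite coef0M mul0r. Qed.

Lemma coefXMS x n : coef (fpsX * x) n.+1 = coef x n.
Proof.
rewrite coef_fpsM !big_ord_recl /= mul0r add0r mul1r subSS subn0.
by rewrite big1 ?addr0 // => i _; rewrite mul0r.
Qed.

Lemma coef_expr_lt x k n : coef x 0 = 0 -> (n < k)%N -> coef (x ^+ k) n = 0.
Proof.
move=> x0; elim: k n => // k IH n ltnk; rewrite exprS coef_fpsM.
rewrite big_ord_recl x0 mul0r add0r big1 // => i _.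
by rewrite IH ?mulr0 // lift0; move: (ltn_ord i); lia.
Qed.

(** The inverse is the geometric series of [x]: as [x ^+ k] vanishes below
    degree [k], its degree-[n] coefficient is that of a finite partial sum. *)
Lemma fps_geometric x : coef x 0 = 0 -> 1 - x \is a GRing.unit.
Proof.
move=> x0; apply/unitrP.
pose g := FPS (fun n => coef (\sum_(k < n.+1) x ^+ k) n).
suff gx : g * (1 - x) = 1 by exists g; split=> //; rewrite mulrC.
apply: fpsP => n.
have trunc i : (i <= n)%N -> coef g i = coef (\sum_(k < n.+1) x ^+ k) i.
  move=> le_in; rewrite /= !coef_sum -!(big_mkord xpredT (fun k => coef (x ^+ k) i)).
  rewrite (@big_cat_nat _ _ _ i.+1 0 n.+1) //= [X in _ = _ + X]big1_seq ?addr0 //.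
  by move=> k /=; rewrite mem_index_iota => /andP[lt_ik _]; exact: coef_expr_lt.
transitivity (coef ((\sum_(k < n.+1) x ^+ k) * (1 - x)) n).
  by rewrite !coef_fpsM; apply: eq_bigr => i _; rewrite trunc // -ltnS.
rewrite mulrC -opprB mulNr -subrX1 opprB coef_fpsD coef_fpsN.
by rewrite (coef_expr_lt x0) // subr0.
Qed.

End PowerSeries.

Lemma fps_unit_coef0 (F : fieldType) (x : fps F) :
  coef x 0 != 0 -> x \is a GRing.unit.
Proof.
move=> x0; pose c : fps F := FPS (fun n => (coef x 0)^-1 *+ (n == 0%N)).
suff: x * c \is a GRing.unit by rewrite unitrM => /andP[].
rewrite -[x * c](subKr 1); apply: fps_geometric.
by rewrite coef_fpsD coef_fpsN coef0M coef_fps1 /= mulr1n mulfV // subrr.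
Qed.

(** * Enumeration of the continuations of a path *)

(** Indexes the non-up steps by the drop in height, so that [Hor] and the
    [Down] steps are counted by a single sum. *)
Definition fall (k : nat) : step := if k is j.+1 then Down j else Hor.

Lemma fall_inj : injective fall.
Proof. by move=> [|i] [|j] //= [->]. Qed.

Lemma rise_fall k : rise (fall k) = - k%:Z.
Proof. by case: k. Qed.

Definition up_follows (s t : step) : bool := (s != Up) ==> (t == Up).

Fixpoint nonneg_from (h : int) (p : seq step) : bool :=
  (0 <= h) && (if p is s :: q then nonneg_from (h + rise s) q else true).

(** Allowing an arbitrary starting height makes the quadrant condition
    structurally recursive on the path. *)
Lemma nonneg_fromP (h : int) p :
  reflect (forall i : 'I_(size p).+1, 0 <= h + height (take i p))
          (nonneg_from h p).
Proof.
have height_cons s q : height (s :: q) = rise s + height q.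
  by rewrite /height big_cons.
have height_nil : height [::] = 0 by rewrite /height big_nil.
elim: p h => [|s p IH] h /=.
  rewrite andbT; apply: (iffP idP) => [h0 i|/(_ ord0)]; rewrite height_nil addr0 //.
apply: (iffP andP) => [[h0 /IH hp] [[|i] lti] /=|hp]; rewrite ?height_nil ?addr0 //.
  by rewrite height_cons addrA; exact: (hp (Ordinal (lti : (i < (size p).+1)%N))).
split; first by have := hp ord0; rewrite /= height_nil addr0.
apply/IH => i; have := hp (lift ord0 i).
by rewrite /= height_cons addrA.
Qed.

Lemma in_quadrantE p : in_quadrant p = nonneg_from 0 p.
Proof.
by apply/forallP/nonneg_fromP => hp i; have := hp i; rewrite add0r.
Qed.

(** [forced] records that the step just read was not an up step. *)
Fixpoint continuations (forced : bool) (h n : nat) : seq (seq step) :=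
  if n is m.+1 then
    [seq Up :: p | p <- continuations false h.+1 m] ++
    (if forced then [::] else
       [seq fall k :: p | k <- iota 0 h.+1, p <- continuations true (h - k) m])
  else [:: [::]].

Lemma continuationsS forced h n :
  continuations forced h n.+1 =
  [seq Up :: p | p <- continuations false h.+1 n] ++
  (if forced then [::] else
     [seq fall k :: p | k <- iota 0 h.+1, p <- continuations true (h - k) n]).
Proof. by []. Qed.

Lemma mem_continuations (s : step) (h n : nat) p :
  (p \in continuations (s != Up) h n) =
  [&& size p == n, nonneg_from h p & path up_follows s p].
Proof.
elim: n s h p => [|n IH] s h p.
  by rewrite /= inE -size_eq0; case: p.
rewrite continuationsS mem_cat.
case: p => [|t p].
  apply/negP => /orP[/mapP[?] //|]; case: ifP => // _.
  by case/allpairsPdep => [? [? []]].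
have -> : (t :: p \in [seq Up :: p | p <- continuations false h.+1 n]) =
          (t == Up) && (p \in continuations (Up != Up) h.+1 n).
  apply/mapP/andP => [[q qin [-> ->]]|[/eqP -> pin]]; last by exists p.
  by rewrite eqxx.
rewrite IH /= eqSS /up_follows.
have [->|tnU] /= := eqVneq t Up.
  have -> : (Up :: p \in (if s != Up then [::] else
     [seq fall k :: p | k <- iota 0 h.+1, p <- continuations true (h - k) n])) = false.
    case: ifP => // _; apply/negP => /allpairsPdep[[|k] [q [_ _ //]]].
  rewrite orbF implybT /=; congr (_ && (_ && _)).
  by have -> : h.+1%:Z = h%:Z + 1 by lia.
have [k ->] : exists k, t = fall k by case: t tnU => [||j]; [|exists 0%N|exists j.+1].
case: (s != Up); first by rewrite !andbF.
have fallnU : fall k != Up by case: (k).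
rewrite /= rise_fall.
have -> : (fall k :: p \in
    [seq fall k0 :: p0 | k0 <- iota 0 h.+1, p0 <- continuations true (h - k0) n]) =
    (k <= h)%N && (p \in continuations (fall k != Up) (h - k) n).
  rewrite fallnU; apply/allpairsPdep/andP => [[j [q []]]|[le_kh pin]].
    by rewrite mem_iota => /= le_jh qin [/fall_inj -> ->].
  by exists k, p; rewrite mem_iota.
rewrite IH; have [le_kh|lt_hk] := leqP k h.
  by rewrite /= subzn.
apply/esym/negP => /and3P[_ + _]; case: p => /= [|? ?]; lia.
Qed.

Lemma uniq_continuations forced h n : uniq (continuations forced h n).
Proof.
elim: n forced h => // n IH forced h; rewrite continuationsS cat_uniq.
rewrite map_inj_uniq ?IH; last by move=> p q [].
case: forced => //; apply/and3P; split=> //.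
  apply/hasPn => p /allpairsPdep[k [q [_ _ ->]]].
  by apply/mapP => -[q' _]; case: k.
apply: (allpairs_uniq_dep (s := iota 0 h.+1)) => //.
- exact: iota_uniq.
- move=> [k p] [l q] _ _ /= [/fall_inj -> ->] //.
Qed.

(** At the origin nothing is forced: the start of a path behaves as if it were
    preceded by an up step. *)
Lemma a_continuations n : a n = size (continuations false 0 n).
Proof.
rewrite /a; have -> : fset_set (M2_of_length n) =
    [fset p in continuations false 0 n]%fset.
  apply/fsetP => p; rewrite in_fset_set; last exact: finite_M2_of_length.
  rewrite in_fset /= (mem_continuations Up) -in_quadrantE.
  apply/idP/and3P; rewrite in_setE.
    move=> [/andP[quad up] sz].
    by split=> //; [exact/eqP | case: p up {quad sz}].
  move=> [/eqP sz quad up]; split=> //; apply/andP; split=> //.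
  by case: p up {quad sz}.
by rewrite card_fseq undup_id // uniq_continuations.
Qed.

(** * Counting continuations by power series *)

Lemma size_continuations_forced h n :
  size (continuations true h n.+1) = size (continuations false h.+1 n).
Proof. by rewrite /= cats0 size_map. Qed.

Lemma size_continuations_free h n :
  size (continuations false h n.+1) =
  (size (continuations false h.+1 n) +
   \sum_(j < h.+1) size (continuations true j n))%N.
Proof.
rewrite continuationsS size_cat size_map size_allpairs_dep sumnE big_map.
congr addn; rewrite -(big_mkord xpredT (fun j => size (continuations true j n))).
rewrite big_nat_rev /index_iota subn0.
by apply: eq_bigr => k _; rewrite add0n subSS.
Qed.

(** Any solution of the system enumerates the continuations, because the system
    expresses each coefficient by coefficients of smaller degree. Both counts
    are proved together since a non-up step turns the free case into the forced
    one and an up step does the converse. *)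
Lemma continuations_coef (B : nat -> fps rat) :
  (forall h, B h = 1 + fpsX * B h.+1
                   + fpsX * (fpsX * \sum_(j < h.+1) B j.+1)) ->
  forall n h,
    (size (continuations false h n))%:R = coef (B h) n.+1 /\
    (size (continuations true h n))%:R = coef (B h.+1) n.
Proof.
move=> recB.
have B0 h : coef (B h) 0 = 1 by rewrite recB !coef_fpsD !coefXM0 !addr0.
have BS h n : coef (B h) n.+1 =
    coef (B h.+1) n + coef (fpsX * \sum_(j < h.+1) B j.+1) n.
  by rewrite [in LHS]recB !coef_fpsD !coefXMS coef_fps1 add0r.
elim=> [|n IH] h; first by rewrite BS !B0 coefXM0 addr0.
rewrite size_continuations_forced; split; last by case: (IH h.+1).
rewrite size_continuations_free natrD natr_sum BS coefXMS coef_sum.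
by have [-> _] := IH h.+1; congr (_ + _); apply: eq_bigr => j _; have [_ ->] := IH j.
Qed.

(** * Solution of the linear system *)

Definition sqrt_d : fps rat := fps_sqrt (1 - 2 * fpsX - 3 * fpsX ^+ 2).
Definition num_r : fps rat := fpsX + 1 + sqrt_d.
(** The conjugate [1 / (z (1 + z) r)] of [r], written without division by [z] so
    that it is a power series. *)
Definition small_root : fps rat := 2 / num_r.
(** The constant by which powers of [small_root] have to be multiplied to satisfy
    the equation at height 0. *)
Definition scale : fps rat := (1 - fpsX * (1 + fpsX) * small_root)^-1.

Lemma sqrt_dP : coef sqrt_d 0 = 1 /\ sqrt_d ^+ 2 = 1 - 2 * fpsX - 3 * fpsX ^+ 2.
Proof.
apply: fps_sqrtP => //.
by rewrite !coef_fpsD !coef_fpsN expr2 !coef0M !coef_fpsX !mulr0 !subr0.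
Qed.

Lemma num_r_unit : num_r \is a GRing.unit.
Proof.
apply: fps_unit_coef0.
by rewrite !coef_fpsD coef_fpsX coef_fps1; have [-> _] := sqrt_dP.
Qed.

(** The characteristic equation of the recurrence in [h]; after multiplication
    by [num_r ^+ 2] it becomes the defining equation of [sqrt_d]. *)
Lemma small_rootP :
  small_root - 1 = fpsX * (small_root ^+ 2 - small_root) + (fpsX * small_root) ^+ 2.
Proof.
apply: (mulIr (unitrX 2 num_r_unit)).
have sE : small_root * num_r = 2 by rewrite divrK // num_r_unit.
have [_ d2] := sqrt_dP.
transitivity (2 * num_r - num_r ^+ 2); first by rewrite -sE; ring.
transitivity (fpsX * (2 ^+ 2 - 2 * num_r) + fpsX ^+ 2 * 2 ^+ 2); last by rewrite -sE; ring.
rewrite /num_r.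
transitivity (1 - fpsX ^+ 2 - 2 * fpsX * sqrt_d - sqrt_d ^+ 2); first by ring.
by rewrite d2; ring.
Qed.

Lemma scale_unit : 1 - fpsX * (1 + fpsX) * small_root \is a GRing.unit.
Proof. by rewrite -mulrA; apply: fps_geometric; exact: coefXM0. Qed.

(** From one height to the next, the two sides grow by [scale * small_root ^+ h]
    times the two sides of the characteristic equation; at height 0 the equation
    is the choice of [scale]. *)
Lemma scale_rec h : scale * small_root ^+ h =
  1 + fpsX * (scale * small_root ^+ h.+1)
  + fpsX * (fpsX * \sum_(j < h.+1) scale * small_root ^+ j.+1).
Proof.
elim: h => [|h IH].
  rewrite big_ord1 expr0 mulr1 expr1 -[X in X + _ + _](mulVr scale_unit) -/scale.
  by ring.
rewrite big_ord_recr /=.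
have -> : scale * small_root ^+ h.+1 =
  scale * small_root ^+ h + scale * small_root ^+ h * (small_root - 1).
  by rewrite exprS; ring.
rewrite small_rootP {1}IH !exprS; ring.
Qed.

Lemma gen_M2_scale : fpsX * FPS (fun n => (a n)%:R) = scale - 1.
Proof.
have scale0 : coef scale 0 = 1.
  rewrite -[scale]mulr1 -[X in _ * X](expr0 small_root) scale_rec.
  by rewrite !coef_fpsD !coefXM0 !addr0.
apply: fpsP => -[|n]; rewrite coef_fpsD coef_fpsN coef_fps1.
  by rewrite coefXM0 scale0 subrr.
rewrite coefXMS subr0 /= a_continuations.
have [-> _] := continuations_coef scale_rec n 0.
by rewrite expr0 mulr1.
Qed.

(** * The closed form *)

(** The passage from the power-series root [s] to the Laurent series
    [r = N / (2 u (u + 1)) = 1 / (u (u + 1) s)]. An abstract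
    field keeps the normalisation away from the construction of fractions. *)
Lemma conjugate_root_identity (F : fieldType) (u s N b g : F) :
  (2 : F) != 0 -> u != 0 -> u + 1 != 0 ->
  s * N = 2 -> b * (1 - u * (1 + u) * s) = 1 -> u * g = b - 1 ->
  g = 1 / (u * (N / (2 * u * (u + 1)) - 1)).
Proof.
move=> two_neq0 u0 u1_neq0 sN bE ug.
have s0 : s != 0 by apply: contra_neq two_neq0 => s0; rewrite -sN s0 mul0r.
have den_neq0 : 1 - u * (1 + u) * s != 0.
  by apply/eqP => d0; move/eqP: bE; rewrite d0 mulr0 eq_sym oner_eq0.
have -> : N = 2 / s by rewrite -sN mulrAC divff // mul1r.
have -> : g = (b - 1) / u by rewrite -ug mulrAC divff // mul1r.
have -> : b = (1 - u * (1 + u) * s)^-1 by rewrite -[LHS](mulfK den_neq0) bE mul1r.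
field.
rewrite u1_neq0 u0 two_neq0 s0 /=.
by have <- : 1 - u * (1 + u) * s = 1 + -1 * (s * (u * (u + 1))) by ring.
Qed.

Theorem corollary4 : gen_M2 = 1 / (z * (r - 1)).
Proof.
have of_fpsM (x y : fps rat) : of_fps (x * y) = of_fps x * of_fps y by exact: rmorphM.
have of_fpsD (x y : fps rat) : of_fps (x + y) = of_fps x + of_fps y by exact: rmorphD.
have of_fpsN (x : fps rat) : of_fps (- x) = - of_fps x by exact: rmorphN.
have of_fps1 : of_fps 1 = 1 by exact: rmorph1.
have of_fps_inj (x y : fps rat) : of_fps x = of_fps y -> x = y.
  by move=> /eqP; rewrite /of_fps tofrac_eq => /eqP.
have z0 : z != 0.
  apply/eqP => /(of_fps_inj fpsX 0)/(congr1 (fun x => coef x 1))/eqP.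
  by rewrite oner_eq0.
have z1_neq0 : z + 1 != 0.
  rewrite -of_fps1 -of_fpsD.
  apply/eqP => /(of_fps_inj _ 0)/(congr1 (fun x => coef x 0))/eqP.
  by rewrite coef_fpsD add0r oner_eq0.
have two : of_fps 2 = 2 by exact: rmorph_nat.
have two_neq0 : (2 : laurent) != 0.
  rewrite -two; apply/eqP => /(of_fps_inj _ 0)/(congr1 (fun x => coef x 0))/eqP.
  by rewrite coef_fpsD.
have /(congr1 of_fps) : small_root * num_r = 2 by rewrite divrK // num_r_unit.
rewrite of_fpsM two => rootE.
have /(congr1 of_fps) := mulVr scale_unit; rewrite -/scale.
rewrite of_fpsM of_fpsD of_fpsN 2!of_fpsM of_fpsD of_fps1 -/z => scaleE.
have /(congr1 of_fps) := gen_M2_scale.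
rewrite of_fpsM of_fpsD of_fpsN of_fps1 -/z -/gen_M2 => genE.
have -> : r = of_fps num_r / (2 * z * (z + 1)).
  by rewrite /r /num_r !of_fpsD of_fps1.
exact: conjugate_root_identity rootE scaleE genE.
Qed.
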